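(* Let $X\in\mathbb{R}^{n\times p}$ have unit $\ell_2$-norm columns and worst-case coherence $\mu>0$, let $\beta\in\mathbb{R}^p$ be $k$-sparse with support $\mathcal{S}$, let $\eta\in\mathbb{R}^n$ have independent $\mathcal{N}(0,\sigma^2)$ entries, and $y=X\beta+\eta$. Suppose $k<\mu^{-1}$ and $$\frac{\beta_{\min}}{\|\beta\|_2}>2\mu\sqrt{k}+\frac{4\sqrt{\sigma^2\log p}}{\|\beta\|_2}.$$ Then, with probability exceeding $1-2\big(p\sqrt{2\pi\log p}\big)^{-1}$, the output $\hat{\mathcal{S}}$ of Algorithm 1 satisfies $\mathcal{S}\subset\hat{\mathcal{S}}$ for every integer $d\le p$ with $$d\ge\left\lceil\frac{\sqrt{k}}{\frac{\beta_{\min}}{\|\beta\|_2}-2\mu\sqrt{k}-\frac{4\sqrt{\sigma^2\log p}}{\|\beta\|_2}}\right\rceil.$$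
   Context: Worst-case coherence of $X$ with unit-norm columns $X_1,\dots,X_p$: $\mu=\max_{i\ne j}|X_i^\top X_j|$. $[[p]]=\{1,\dots,p\}$, $p\ge2$, $k<n$, $\sigma>0$. $\beta$ (deterministic) is $k$-sparse with support $\mathcal{S}=\{i:\beta_i\ne0\}$, $|\mathcal{S}|=k$; $\beta_{\min}=\min_{i\in\mathcal{S}}|\beta_i|$. Algorithm 1: given $X$, $y$ and an integer $d\in\{1,\dots,p\}$, compute $w=X^\top y$ and output $\hat{\mathcal{S}}\subset[[p]]$ with $|\hat{\mathcal{S}}|=d$ such that $|w_i|\ge|w_j|$ for all $i\in\hat{\mathcal{S}}$, $j\notin\hat{\mathcal{S}}$ (ties broken arbitrarily). *)

(* Defs.v *)
From HB Require Import structures.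
From mathcomp Require Import all_boot all_order all_algebra.
From mathcomp Require Import all_classical all_reals all_analysis.
Set Implicit Arguments. Unset Strict Implicit. Unset Printing Implicit Defensive.
Import Order.TTheory GRing.Theory Num.Theory.
Local Open Scope classical_set_scope.
Local Open Scope ring_scope.

Definition col_dot {R : realType} {n p : nat} (X : 'M[R]_(n, p)) (i j : 'I_p) : R :=
  \sum_(r < n) X r i * X r j.

Definition unit_norm_cols {R : realType} {n p : nat} (X : 'M[R]_(n, p)) : Prop :=
  forall i : 'I_p, col_dot X i i = 1.

Definition coherence {R : realType} {n p : nat} (X : 'M[R]_(n, p)) : R :=
  \big[Num.max/0]_(ij : 'I_p * 'I_p | ij.1 != ij.2) `|col_dot X ij.1 ij.2|.

Definition l2norm {R : realType} {p : nat} (v : 'I_p -> R) : R :=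
  Num.sqrt (\sum_(i < p) v i ^+ 2).

Definition supp {R : realType} {p : nat} (beta : 'I_p -> R) : {set 'I_p} :=
  [set i | beta i != 0].

Definition corr {R : realType} {n p : nat} (X : 'M[R]_(n, p)) (y : 'I_n -> R)
  (i : 'I_p) : R := \sum_(r < n) X r i * y r.

(* Shat is an admissible output of Algorithm 1 (any tie-breaking) with
   parameter d, on data X, y. *)
Definition alg1_output {R : realType} {n p : nat} (X : 'M[R]_(n, p))
  (y : 'I_n -> R) (d : nat) (Shat : {set 'I_p}) : Prop :=
  #|Shat| = d /\
  forall i j : 'I_p, i \in Shat -> j \notin Shat ->
    `|corr X y j| <= `|corr X y i|.

Definition response {R : realType} {n p : nat} (X : 'M[R]_(n, p))
  (beta : 'I_p -> R) (eta : 'I_n -> R) (r : 'I_n) : R :=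
  \sum_(i < p) X r i * beta i + eta r.

(* mutual independence of a finite family of real random variables:
   the joint law factorizes on every product of Borel sets (taking some
   B_i = setT gives the factorization for every subfamily). *)
Definition mutually_independent_RV {d} {T : measurableType d} {R : realType}
  (P : probability T R) {n : nat} (eta : 'I_n -> {RV P >-> R}) : Prop :=
  forall B : 'I_n -> set R, (forall i, measurable (B i)) ->
    P (\bigcap_(i in [set: 'I_n]) (eta i @^-1` B i)) =
    (\prod_(i < n) P (eta i @^-1` B i))%E.

(* Main.v *)
(**
  On the event that every noise correlation [|<X_i, eta>|] is at most
  [tau = 2 sqrt(sigma^2 ln p)], each [|w_i - beta_i|] is at most
  [mu |beta|_1 + tau]. If some [i] in the support were missed, all [d]
  selected columns would satisfy [|w_j| >= |w_i|], hence
  [|beta_j| >= bmin - 2 mu |beta|_1 - 2 tau]; summing over the selected set and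
  using [|beta|_1 <= sqrt k |beta|_2] contradicts the lower bound on [d].

  As the columns have unit norm, each [<X_i, eta>] is exactly N(0, sigma^2),
  and the Mills-ratio bound on the Gaussian tail with a union bound over the [p]
  columns gives failure probability at most [1 / (p sqrt(2 pi ln p))].
*)
Require Import Defs.
From HB Require Import structures.
From mathcomp Require Import all_boot all_order all_algebra.
From mathcomp Require Import all_classical all_reals all_analysis.
From mathcomp Require Import measurable_realfun.
From mathcomp Require Import ring lra.
Import Order.TTheory GRing.Theory Num.Theory.
Import numFieldNormedType.Exports.
Local Open Scope classical_set_scope.
Local Open Scope ring_scope.

Local Notation pushforward_measure :=
  measure_function_pushforward__canonical__measure_function_Measure.

(** * Gaussian measures on the line *)

Section Gaussian.
Context {R : realType}.
Local Notation mu := (@lebesgue_measure R).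
Implicit Types (m s t a b x y z : R) (A : set R).

Definition affine a b : R -> R := fun y => a * y + b.

Lemma measurable_affine a b : measurable_fun [set: R] (affine a b).
Proof. by apply: measurable_funD => //; exact: measurable_funM. Qed.

Let measurable_affineR a b : @measurable_fun _ _ (measurableTypeR R)
  (measurableTypeR R) setT (affine a b).
Proof. exact: measurable_affine. Qed.

(** A negative slope swaps the endpoints and the closed side, which leaves the length formula
    unchanged. *)
Lemma lebesgue_measure_affine_itv a b c d : a != 0 ->
  lebesgue_measure (affine a b @^-1` `]c, d]) =
  ((`|a|^-1)%:E * lebesgue_measure `]c, d])%E.
Proof.
move=> a0; rewrite lebesgue_measure_itv /= lte_fin.
have [an|ap] := orP (etrans (esym (neq_lt a 0)) a0); last first.
  have -> : affine a b @^-1` `]c, d] = `]((c - b) / a), ((d - b) / a)]%classic.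
    apply/seteqP; split => y /=; rewrite /affine !in_itv /=;
    by rewrite ltr_pdivrMr // ler_pdivlMr // ltrBlDr lerBrDr mulrC.
  rewrite lebesgue_measure_itv /= lte_fin ltr_pM2r ?invr_gt0 // ltrD2r.
  case: ifPn; rewrite ?mule0 // => _; rewrite gtr0_norm // -!EFinD -EFinM.
  by congr (_%:E); field; rewrite gt_eqF.
have -> : affine a b @^-1` `]c, d] = `[((d - b) / a), ((c - b) / a)[%classic.
  apply/seteqP; split => y /=; rewrite /affine !in_itv /=;
  by rewrite ltr_ndivlMr // ler_ndivrMr // ltrBlDr lerBrDr mulrC andbC.
rewrite lebesgue_measure_itv /= lte_fin ltr_nM2r ?invr_lt0 // ltrD2r.
case: ifPn; rewrite ?mule0 // => _; rewrite ltr0_norm // -!EFinD -EFinM.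
by congr (_%:E); field; rewrite lt_eqF.
Qed.

(** Lebesgue measure is determined by its values on half-open intervals, where the factor [|a|]
    cancels the scaling of the preimage by [|a|^-1]. *)
Lemma lebesgue_measure_affine a b A : a != 0 -> measurable A ->
  mu A = mscale (NngNum (normr_ge0 a)) (pushforward_measure mu (measurable_affineR a b)) A.
Proof.
move=> a0 mA; apply: lebesgue_measure_unique => // _ [[c d]] _ <- /=.
rewrite /mscale /= [X in (_ = _ * X)%E](lebesgue_measure_affine_itv a b c d a0).
by rewrite muleA -EFinM divff ?mul1e // normr_eq0.
Qed.

Lemma ge0_integral_affine a b A (f : R -> \bar R) : a != 0 -> measurable A ->
  measurable_fun [set: R] f -> (forall x, 0 <= f x)%E ->
  (\int[mu]_(x in A) f x =
   \int[mu]_(y in affine a b @^-1` A) (`|a|%:E * f (affine a b y)))%E.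
Proof.
move=> a0 mA mf f0.
rewrite (eq_measure_integral
  (mscale (NngNum (normr_ge0 a)) (pushforward_measure mu (measurable_affineR a b)))); last first.
  by move=> B mB _; exact: lebesgue_measure_affine.
have mfA : measurable_fun A f by exact: measurable_funTS.
rewrite ge0_integral_mscale //=.
rewrite (ge0_integral_pushforward (measurable_affineR a b)) //.
rewrite ge0_integralZl //.
- by rewrite -[X in measurable X]setTI; exact: measurable_affine.
- by apply: measurable_funTS; apply: measurableT_comp => //; exact: measurable_affine.
Qed.

Lemma normal_peak_scale a s : a != 0 ->
  normal_peak s = `|a| * normal_peak (a * s).
Proof.
move=> a0; rewrite /normal_peak exprMn -[in RHS]mulrA -[in RHS]mulrnAr [in RHS]sqrtrM ?sqr_ge0 // sqrtr_sqr.
by rewrite invfM mulrA divff ?mul1r // normr_eq0.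
Qed.

Lemma normal_pdf_affine a b m s y : a != 0 -> s != 0 ->
  normal_pdf m s y = `|a| * normal_pdf (affine a b m) (a * s) (affine a b y).
Proof.
move=> a0 s0; rewrite !normal_pdfE ?mulf_neq0 // (normal_peak_scale a) //.
rewrite mulrA; congr (_ * _); rewrite /normal_fun /affine; congr expR.
by field; rewrite a0 s0.
Qed.

(** Change of variables in the density. The scale [a * s] may be negative: the density depends on it
    only through its square. *)
Lemma normal_prob_affine a b m s A : a != 0 -> s != 0 -> measurable A ->
  normal_prob m s (affine a b @^-1` A) = normal_prob (affine a b m) (a * s) A.
Proof.
move=> a0 s0 mA; rewrite /normal_prob [RHS](ge0_integral_affine a b) //.
- by apply: eq_integral => y _; rewrite (normal_pdf_affine a b) // EFinM.
- by apply/measurable_EFinP; exact: measurable_normal_pdf.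
- by move=> x; rewrite lee_fin normal_pdf_ge0.
Qed.

(** The density [normal_pdf m s] is a version of the Radon-Nikodym derivative: both have the same
    integral over every measurable set, hence agree almost everywhere. *)
Lemma integral_normal_prob m s (f : R -> \bar R) :
  measurable_fun [set: R] f ->
  (\int[normal_prob m s]_x `|f x| < +oo)%E ->
  (\int[normal_prob m s]_x f x = \int[mu]_x (f x * (normal_pdf m s x)%:E))%E.
Proof.
move=> mf finf.
have dom := normal_prob_dominates m s.
rewrite -(Radon_Nikodym_change_of_variables dom) //=; last first.
  by apply/integrableP; split.
apply: ae_eq_integral => //.
- by apply: emeasurable_funM.
- apply: emeasurable_funM => //; apply/measurable_EFinP; exact: measurable_normal_pdf.
- apply: ae_eqe_mul2l => /=.
  rewrite Radon_NikodymE //=; case: cid => /= h [h1 h2 h3].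
  apply: integral_ae_eq => //=.
  + by apply/measurable_EFinP; exact: measurable_normal_pdf.
  + by move=> E _ mE; rewrite -h3.
Qed.

(** * Convolution of centred Gaussians *)

Lemma normal_peak_convolution s t : s != 0 -> t != 0 ->
  normal_peak t * normal_peak s =
  normal_peak (Num.sqrt (s ^+ 2 + t ^+ 2)) *
  normal_peak (s * t / Num.sqrt (s ^+ 2 + t ^+ 2)).
Proof.
move=> s0 t0.
have var_ge0 r : 0 <= r ^+ 2 * pi *+ 2 :> R.
  by rewrite mulrn_wge0 // mulr_ge0 ?pi_ge0 // sqr_ge0.
rewrite /normal_peak -!invfM -!sqrtrM //.
congr (Num.sqrt _)^-1.
have st0 : 0 < s ^+ 2 + t ^+ 2 by rewrite addr_gt0 // exprn_even_gt0.
rewrite expr_div_n sqr_sqrtr ?ltW //; field.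
by rewrite gt_eqF.
Qed.

(** Completing the square in [x]. If [z] is the sum of [x] and an independent Gaussian of scale [t],
    the joint density is the marginal of [z] times the conditional density of [x] given [z]. *)
Lemma normal_pdf_convolution s t x z : s != 0 -> t != 0 ->
  normal_pdf x t z * normal_pdf 0 s x =
  normal_pdf 0 (Num.sqrt (s ^+ 2 + t ^+ 2)) z *
  normal_pdf (s ^+ 2 / (s ^+ 2 + t ^+ 2) * z)
             (s * t / Num.sqrt (s ^+ 2 + t ^+ 2)) x.
Proof.
move=> s0 t0.
have st0 : 0 < s ^+ 2 + t ^+ 2 by rewrite addr_gt0 // exprn_even_gt0.
have r0 : Num.sqrt (s ^+ 2 + t ^+ 2) != 0 by rewrite gt_eqF // sqrtr_gt0.
rewrite !normal_pdfE ?mulf_neq0 ?invr_eq0 // mulrACA normal_peak_convolution //.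
rewrite [RHS]mulrACA; congr (_ * _).
rewrite /normal_fun -!expRD; congr expR.
rewrite expr_div_n sqr_sqrtr ?ltW //; field.
by rewrite gt_eqF // s0 t0.
Qed.

Lemma measurable_normal_pdf2 t : t != 0 ->
  measurable_fun [set: R * R] (fun xz => normal_pdf xz.1 t xz.2).
Proof.
move=> t0.
under eq_fun do rewrite normal_pdfE //.
apply: measurable_funM => //; apply: measurableT_comp => //=.
apply: measurable_funM => //; apply: measurableT_comp => //=.
by apply: measurable_funX => //; exact: measurable_funB.
Qed.

(** The probability is the integral over [z] of a jointly measurable nonnegative function, so
    Tonelli applies. *)
Lemma measurable_normal_prob t A : t != 0 -> measurable A ->
  measurable_fun [set: R] (fun x => normal_prob x t A).
Proof.
move=> t0 mA; pose f (xz : R * R) : \bar R :=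
  ((normal_pdf xz.1 t xz.2)%:E * (\1_A xz.2)%:E)%E.
have -> : (fun x => normal_prob x t A) = fubini_F mu f.
  apply/funext => x; rewrite /normal_prob integral_mkcond.
  by apply: eq_integral => z _; rewrite epatch_indic.
apply: measurable_fun_fubini_tonelli_F => /=; last first.
  by move=> xz; rewrite mule_ge0 // lee_fin normal_pdf_ge0.
apply: emeasurable_funM.
  by apply/measurable_EFinP; exact: measurable_normal_pdf2.
by apply/measurable_EFinP; apply: measurableT_comp => //; exact: measurable_indic.
Qed.

Lemma normal_prob_convolution s t A : s != 0 -> t != 0 -> measurable A ->
  (\int[normal_prob 0 s]_x normal_prob x t A =
   normal_prob 0 (Num.sqrt (s ^+ 2 + t ^+ 2)) A)%E.
Proof.
move=> s0 t0 mA; set u := Num.sqrt _.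
pose f (xz : R * R) : \bar R :=
  ((normal_pdf xz.1 t xz.2)%:E * (\1_A xz.2)%:E)%E.
have f0 xz : (0 <= f xz)%E by rewrite mule_ge0 // lee_fin normal_pdf_ge0.
have mf : measurable_fun [set: R * R] f.
  apply: emeasurable_funM.
    by apply/measurable_EFinP; exact: measurable_normal_pdf2.
  by apply/measurable_EFinP; apply: measurableT_comp => //; exact: measurable_indic.
have NE x : normal_prob x t A = (\int[mu]_z f (x, z))%E.
  rewrite /normal_prob integral_mkcond; apply: eq_integral => z _.
  by rewrite epatch_indic.
have mN := measurable_normal_prob t A t0 mA.
rewrite integral_normal_prob //; last first.
  (* Integrability: the integrand is itself a probability, hence at most 1. *)
  apply: (@le_lt_trans _ _ (\int[normal_prob 0 s]_x (cst 1 x)))%E.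
    apply: ge0_le_integral => //; first exact: measurableT_comp.
    by move=> x _; rewrite gee0_abs // probability_le1.
  by rewrite integral_cst // mul1e ltey_eq fin_num_measure.
pose g (xz : R * R) : \bar R := (f xz * (normal_pdf 0 s xz.1)%:E)%E.
transitivity (\int[mu]_x \int[mu]_z g (x, z))%E.
  apply: eq_integral => x _; rewrite NE -ge0_integralZr //.
  + exact: measurable_fun_pair2.
  + by rewrite lee_fin normal_pdf_ge0.
have g0 xz : (0 <= g xz)%E by rewrite mule_ge0 // lee_fin normal_pdf_ge0.
(* Once the integrals are exchanged, the conditional density in [x] integrates to 1 and only the
   density of [z] remains. *)
rewrite fubini_tonelli //; last first.
  apply: emeasurable_funM => //; apply/measurable_EFinP.
  by apply: measurableT_comp => //; exact: measurable_normal_pdf.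
rewrite /normal_prob [RHS]integral_mkcond; apply: eq_integral => z _.
rewrite epatch_indic.
pose c := s ^+ 2 / (s ^+ 2 + t ^+ 2) * z.
have gE x : g (x, z) =
    ((normal_pdf 0 u z)%:E * (\1_A z)%:E * (normal_pdf c (s * t / u) x)%:E)%E.
  by rewrite /g /f /= -!EFinM mulrAC normal_pdf_convolution // mulrAC.
under eq_integral do rewrite gE.
rewrite ge0_integralZl //.
- by rewrite integral_normal_pdf mule1.
- by apply/measurable_EFinP; exact: measurable_normal_pdf.
- by move=> x _; rewrite lee_fin normal_pdf_ge0.
- by rewrite mule_ge0 // lee_fin // normal_pdf_ge0.
Qed.

(** * Gaussian tail bounds *)

(** Mills ratio: on [[t, +oo[] the density is at most [x / t] times itself, and that product has the
    explicit primitive [F], which vanishes at infinity. *)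
Lemma normal_tail s t : 0 < s -> 0 < t ->
  (normal_prob 0 s `[t, +oo[ <= (s ^+ 2 / t * normal_pdf 0 s t)%:E)%E.
Proof.
move=> s0 t0; have sn0 : s != 0 by rewrite gt_eqF.
pose F x : R := - (s ^+ 2 / t) * normal_pdf 0 s x.
pose f x : R := x / t * normal_pdf 0 s x.
pose c := (s ^+ 2 *+ 2)^-1.
have c0 : 0 < c by rewrite invr_gt0 pmulrn_lgt0 // exprn_gt0.
pose K := - (s ^+ 2 / t) * normal_peak s.
have FE : F = (fun x => K *: expR (- c * x ^+ 2)).
  apply/funext => x; rewrite /F normal_pdfE //= /normal_fun subr0 mulrA.
  by congr (_ * expR _); rewrite mulNr [in RHS]mulNr mulrC.
have dF x : is_derive x 1 F (f x).
  have dX : is_derive x 1 ((- c) \*: (id ^+ 2 : R -> R)) (- c *: ((2%:R * x ^+ 1) *: 1)).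
    exact: is_deriveZ.
  have dE := is_deriveZ K (is_derive1_comp (is_derive_expR _) dX).
  rewrite FE; apply: (is_derive_eq dE).
  rewrite /f normal_pdfE // /normal_fun subr0 /GRing.scale /= mulr1.
  have -> : expR (- c *: (id ^+ 2) x) = expR (- x ^+ 2 / (s ^+ 2 *+ 2)).
    by congr expR; rewrite /GRing.scale /= mulNr mulrC -mulNr.
  by rewrite /K /c; field; rewrite sn0 gt_eqF.
have cf : continuous f.
  move=> x; apply: cvgM; first by apply: cvgMr_tmp; exact: cvg_id.
  exact: continuous_normal_pdf.
have -> : (s ^+ 2 / t * normal_pdf 0 s t)%:E = (0%:E - (F t)%:E)%E.
  by rewrite -EFinB sub0r /F mulNr opprK.
rewrite -(@ge0_continuous_FTC2y _ f F); last 6 first.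
- by move=> x tx; rewrite mulr_ge0 ?normal_pdf_ge0 // divr_ge0 ?ltW // (lt_le_trans t0).
- exact: continuous_subspaceT.
- rewrite FE -(mulr0 K); apply: cvgMl_tmp.
  under eq_fun do rewrite mulNr.
  apply: (cvg_comp (fun x => c * x ^+ 2) (fun x => expR (- x))); last exact: cvgr_expR.
  by apply: gt0_cvgMry => //; exact: cvgr_expr2.
- by move=> x _; exact: ex_derive.
- apply: cvg_at_right_filter; apply: cvgMl_tmp; exact: continuous_normal_pdf.
- by move=> x _; rewrite derive1E derive_val.
apply: ge0_le_integral => //.
- by move=> x _; rewrite lee_fin normal_pdf_ge0.
- by apply: measurable_funTS; apply/measurable_EFinP; exact: measurable_normal_pdf.
- by apply: measurable_funTS; apply/measurable_EFinP; exact: continuous_measurable_fun.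
- move=> x /=; rewrite in_itv /= andbT => tx.
  by rewrite lee_fin ler_peMl ?normal_pdf_ge0 // ler_pdivlMr // mul1r.
Qed.

Lemma normal_probN m s : normal_prob m (- s) = normal_prob m s.
Proof.
by apply/funext => A; rewrite /normal_prob /normal_pdf /normal_peak /normal_fun
  oppr_eq0 sqrrN.
Qed.

(** The reflection of slope -1 preserves the centred law, so the two tails obey the same bound. *)
Lemma normal_two_sided_tail s t : 0 < s -> 0 < t ->
  (normal_prob 0 s [set x : R | (t <= `|x|)%R] <=
   (2 * (s ^+ 2 / t * normal_pdf 0 s t))%:E)%E.
Proof.
move=> s0 t0; have sn0 : s != 0 by rewrite gt_eqF.
set I : set R := `[t, +oo[%classic.
have mI : measurable I by exact: measurable_itv.
have mJ : measurable (affine (-1) 0 @^-1` I).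
  by rewrite -[X in measurable X]setTI; exact: measurable_affine.
have EJ : normal_prob 0 s (affine (-1) 0 @^-1` I) = normal_prob 0 s I.
  rewrite normal_prob_affine ?oppr_eq0 ?oner_eq0 //.
  by rewrite /affine mulr0 addr0 mulN1r normal_probN.
have sub : [set x | t <= `|x|] `<=` I `|` affine (-1) 0 @^-1` I.
  move=> x /=; rewrite ler_normr /I /= /affine !in_itv /= !andbT mulN1r addr0.
  by case/orP; [left|right].
have mN : measurable [set x : R | t <= `|x|].
  rewrite -[X in measurable X]setTI.
  apply: measurable_fun_le => //; exact: measurableT_comp.
apply: (@le_trans _ _ (normal_prob 0 s (I `|` affine (-1) 0 @^-1` I))).
  by apply: le_measure => //; rewrite inE //; exact: measurableU.
apply: (le_trans (measureU2 _ _ _)) => //.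
rewrite mulr2n mulrDl mul1r EFinD leeD //; first exact: normal_tail.
by have := normal_tail _ _ s0 t0; rewrite -EJ.
Qed.

End Gaussian.

(** * Thresholding under bounded noise *)

Section Deterministic.
Context {R : realType} {n p : nat}.
Implicit Types (X : 'M[R]_(n, p)) (beta : 'I_p -> R) (eta : 'I_n -> R).

Lemma col_dot_le_coherence X i j : i != j -> `|col_dot X i j| <= coherence X.
Proof.
move=> ij; rewrite /coherence.
exact: (le_bigmax_cond 0 (fun ij => `|col_dot X ij.1 ij.2|) (j := (i, j))).
Qed.

Lemma coherence_ge0 X : 0 <= coherence X.
Proof. exact: bigmax_ge_id. Qed.

Lemma corr_response X beta eta i :
  corr X (response X beta eta) i =
  \sum_(j < p) col_dot X i j * beta j + corr X eta i.
Proof.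
rewrite /corr /response.
under eq_bigr do rewrite mulrDr mulr_sumr.
rewrite big_split /=; congr (_ + _).
rewrite exchange_big /=; apply: eq_bigr => j _.
by rewrite /col_dot mulr_suml; apply: eq_bigr => r _; rewrite mulrA.
Qed.

(** With unit columns the diagonal term is exactly [beta i]; the off-diagonal coefficients are
    bounded by the coherence. *)
Lemma corr_response_dist X beta eta i : unit_norm_cols X ->
  `|corr X (response X beta eta) i - beta i| <=
  coherence X * \sum_(j < p) `|beta j| + `|corr X eta i|.
Proof.
move=> uX; rewrite corr_response (bigD1 i) //= uX mul1r.
rewrite [t in `|t| <= _]addrC -addrA addKr (le_trans (ler_normD _ _)) // lerD2r.
(* The missing term [|beta i|] is put back so that the bound involves the full l1 norm and is
   uniform in [i]. *)
rewrite (le_trans (ler_norm_sum _ _ _)) // [in leRHS](bigD1 i) //= mulrDr.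
rewrite ler_wpDl ?mulr_ge0 ?coherence_ge0 //.
rewrite mulr_sumr; apply: ler_sum => j ji; rewrite normrM ler_wpM2r //.
by rewrite col_dot_le_coherence // eq_sym.
Qed.

(** If [i] is missed, the selected entries alone already have l1 mass at least [|beta|_1], leaving
    no room for [|beta i| >= bmin > 0]. *)
Lemma alg1_output_supp X beta eta (bmin tau : R) d Shat :
  unit_norm_cols X -> 0 < bmin ->
  (forall i, i \in supp beta -> bmin <= `|beta i|) ->
  (forall i, `|corr X eta i| <= tau) ->
  \sum_(j < p) `|beta j| <=
    d%:R * (bmin - 2 * coherence X * \sum_(j < p) `|beta j| - 2 * tau) ->
  alg1_output X (response X beta eta) d Shat ->
  supp beta \subset Shat.
Proof.
move=> uX b0 hb htau hd [cS hS]; apply/fintype.subsetP => i iS.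
apply: contraT => inS; have bi := hb _ iS.
set L := \sum_(j < p) _ in hd.
set w := corr X (response X beta eta).
have dist j : `|w j - beta j| <= coherence X * L + tau.
  by rewrite (le_trans (corr_response_dist _ _ _ _ uX)) // lerD2l.
have low j : j \in Shat -> bmin - 2 * coherence X * L - 2 * tau <= `|beta j|.
  (* With [e = mu L + tau]: [|beta j| >= |w j| - e >= |w i| - e >= |beta i| - 2 e]. *)
  move=> jS; have := hS _ _ jS inS; rewrite -/w => wij.
  have := dist i; have := dist j.
  have := ler_normB (w j) (w j - beta j); have := ler_normB (w i) (w i - beta i).
  rewrite !subKr; have := ler_normD (w j - beta j) (beta j); rewrite subrK.
  lra.
have : d%:R * (bmin - 2 * coherence X * L - 2 * tau) <= \sum_(j in Shat) `|beta j|.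
  by rewrite -cS mulr_natl -sumr_const; apply: ler_sum.
have : \sum_(j in Shat) `|beta j| + `|beta i| <= L.
  rewrite /L [in leRHS](bigID (mem Shat)) /= lerD2l (bigD1 i) //=.
  by rewrite ler_wpDr // sumr_ge0.
lra.
Qed.

(** Both norms see only the support, so the factor is the square root of its size rather than of
    [p]. *)
Lemma l1norm_le_sqrt_supp beta :
  \sum_(j < p) `|beta j| <= Num.sqrt #|supp beta|%:R * l2norm beta.
Proof.
set k := #|supp beta|; set L := \sum_(j < p) _.
have LE : L = \sum_(j in supp beta) `|beta j|.
  rewrite /L (bigID (mem (supp beta))) /= [X in _ + X]big1 ?addr0 // => j.
  by rewrite inE negbK => /eqP ->; rewrite normr0.
have QE : \sum_(j < p) beta j ^+ 2 = \sum_(j in supp beta) `|beta j| ^+ 2.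
  rewrite (bigID (mem (supp beta))) /= [X in _ + X]big1 ?addr0 => [|j].
    by apply: eq_bigr => j _; rewrite real_normK ?num_real.
  by rewrite inE negbK => /eqP ->; rewrite expr0n.
have L0 : 0 <= L by rewrite sumr_ge0.
rewrite /l2norm -sqrtrM ?ler0n // -(ger0_norm L0) -sqrtr_sqr ler_wsqrtr // QE.
have [k0|k0] := posnP k.
  by rewrite LE !big_pred0 ?expr0n ?mulr0 // => j; apply: card0_eq.
have k0R : (0 : R) < k%:R by rewrite ltr0n.
(* Cauchy-Schwarz from the nonnegativity of the variance *)
have : 0 <= \sum_(j in supp beta) (`|beta j| - L / k%:R) ^+ 2.
  by apply: sumr_ge0 => j _; exact: sqr_ge0.
under eq_bigr => j _ do rewrite sqrrB -mulrnAl.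
rewrite big_split /= sumrB -mulr_suml sumrMnl -LE sumr_const -/k.
(* Multiplied by [k], the expanded sum of squares is [k] times the squared l2 norm minus [L^2]. *)
rewrite -(pmulr_rge0 _ k0R) => h; rewrite -subr_ge0; congr (_ <= _) : h.
by rewrite -mulr_natr -[in L *+ 2]mulr_natr; field; rewrite gt_eqF.
Qed.

End Deterministic.

(** * Linear combinations of independent Gaussians *)

Section CenteredNormal.
Context {R : realType}.

(* [normal_prob 0 0] is the uniform law on [0, 1], not the Dirac mass at 0. *)
Definition centered_normal (v : R) : probability (measurableTypeR R) R :=
  if v == 0 then (\d_(0 : measurableTypeR R) : probability _ R)
  else (normal_prob 0 (Num.sqrt v) : probability _ R).

(** For [v = 0] the Dirac mass evaluates the kernel at centre 0; otherwise Gaussian variances add. A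
    negative [t] is replaced by [-t]. *)
Lemma centered_normal_convolution (v t : R) (A : set R) :
  0 <= v -> t != 0 -> measurable A ->
  (\int[centered_normal v]_x normal_prob x t A = centered_normal (v + t ^+ 2) A)%E.
Proof.
move=> v0 t0 mA; rewrite /centered_normal.
have t20 : 0 < t ^+ 2 by rewrite exprn_even_gt0.
have -> : (v + t ^+ 2 == 0) = false by rewrite gt_eqF // ltr_wpDl.
have [->|vn0] := eqVneq v 0; last first.
  by rewrite normal_prob_convolution ?sqr_sqrtr // sqrtr_eq0 -ltNge lt_def vn0.
rewrite integral_dirac //=; last exact: measurable_normal_prob.
rewrite diracT mul1e add0r sqrtr_sqr.
have [tp|tn] := leP 0 t; first by rewrite ger0_norm.
by rewrite ltr0_norm //= normal_probN.
Qed.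

End CenteredNormal.

Section IndependentSum.
Context {R : realType} {d} {T : measurableType d} (P : probability T R).

(* Conditionally on [E], [(Y, Z)] follows a product law; [product_measure_unique]
   extends this from rectangles to the events [Y + b Z \in A]. *)
Lemma centered_normal_sum (Y Z : T -> R) (E : set T) (v s b : R) (A : set R) :
  measurable_fun [set: T] Y -> measurable_fun [set: T] Z -> measurable E ->
  0 <= v -> s != 0 ->
  (forall A B, measurable A -> measurable B ->
    P (Y @^-1` A `&` Z @^-1` B `&` E) =
    (centered_normal v A * (normal_prob 0 s B * P E))%E) ->
  measurable A ->
  P ((fun w => Y w + b * Z w) @^-1` A `&` E) =
    (centered_normal (v + (b * s) ^+ 2) A * P E)%E.
Proof.
move=> mY mZ mE v0 s0 indep mA.
(* Slope 0 is outside the affine change of variables; here [B = setT] in the independence hypothesis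
   suffices. *)
have [->|b0] := eqVneq b 0.
  rewrite mul0r expr0n addr0.
  have := indep A setT mA measurableT; rewrite preimage_setT setIT.
  have -> : normal_prob 0 s [set: R] = 1%E by exact: (probability_setT (normal_prob 0 s)).
  rewrite mul1e => <-; congr (P (_ `&` _)).
  by apply/seteqP; split => w /=; rewrite mul0r addr0.
have mYZ : measurable_fun [set: T] (fun w => (Y w, Z w) : measurableTypeR R * measurableTypeR R).
  exact: measurable_fun_pair.
pose C := [set xy : measurableTypeR R * measurableTypeR R | A (xy.1 + b * xy.2)].
have mC : measurable C.
  rewrite -[C]setTI; apply: (measurable_funD (f := fst)) => //.
  by apply: measurable_funM.
(* Conditioning on a null event is impossible, but then both sides vanish. *)
have [PE0|PE0] := eqVneq (P E) 0%E.
  rewrite PE0 mule0; apply/eqP; rewrite eq_le measure_ge0 andbT -PE0.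
  apply: le_measure; rewrite ?inE //; apply: measurableI => //.
  by rewrite -[X in measurable X]setTI; apply: measurable_funD => //; exact: measurable_funM.
have PEfin : P E \is a fin_num by exact: fin_num_measure.
have e0 : 0 <= (fine (P E))^-1 by rewrite invr_ge0 fine_ge0.
have en0 : fine (P E) != 0 by rewrite fine_eq0.
(* [M] is the conditional law of [(Y, Z)] given [E]. *)
pose M := mscale (NngNum e0) (pushforward_measure (mrestr P mE) mYZ).
have key := @product_measure_unique _ _ _ _ R (centered_normal v) (normal_prob 0 s) M.
have {}key : (centered_normal v \x normal_prob 0 s)%E C = M C.
  apply: key => // A' B mA' mB.
  transitivity (((fine (P E))^-1)%:E * P (Y @^-1` A' `&` Z @^-1` B `&` E))%E.
    by [].
  rewrite indep // -[P E]fineK // muleCA; congr (_ * _)%E.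
  by rewrite muleCA -EFinM mulVf // mule1.
have -> : P ((fun w => Y w + b * Z w) @^-1` A `&` E) = ((fine (P E))%:E * M C)%E.
  by rewrite /M /mscale /= muleA -EFinM divff // mul1e.
rewrite -key -[in X in (_ = _ * X)%E](fineK PEfin) muleC; congr (_ * _)%E.
have bs0 : b * s != 0 by rewrite mulf_neq0.
rewrite -(centered_normal_convolution v (b * s) A v0 bs0 mA).
apply: eq_integral => x _ /=.
(* The section at [x] is the event that [x + b Z] lies in [A], whose probability is that of a
   Gaussian centred at [x] with scale [b * s]. *)
have -> : xsection C x = affine b x @^-1` A.
  by apply/seteqP; split => y; rewrite /xsection /= inE /C /affine /= addrC.
by rewrite (normal_prob_affine b x 0 s A b0 s0 mA) /affine mulr0 add0r.
Qed.

End IndependentSum.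

(** * Law of a fixed linear combination of the noise *)

Section NoiseProjection.
Context {R : realType} {d} {T : measurableType d} {P : probability T R} {n : nat}.
Variables (eta : 'I_n -> {RV P >-> R}) (sigma : R) (a : 'I_n -> R).
Hypothesis sigma_gt0 : 0 < sigma.
Hypothesis eta_normal : forall i (A : set R), measurable A ->
  distribution P (eta i) A = normal_prob 0 sigma A.
Hypothesis eta_indep : mutually_independent_RV eta.

Let cylinder (B : 'I_n -> set R) : set T :=
  \bigcap_(i in [set: 'I_n]) (eta i @^-1` B i).

Let measurable_cylinder B : (forall i, measurable (B i)) -> measurable (cylinder B).
Proof.
move=> mB; apply: fin_bigcap_measurable => [|i _]; first exact: finite_finset.
exact: measurable_funPTI.
Qed.

Let partial_sum m (w : T) : R := \sum_(r < n | (r < m)%N) a r * eta r w.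
Let partial_var m : R := \sum_(r < n | (r < m)%N) (a r * sigma) ^+ 2.

Let measurable_partial_sum m : measurable_fun [set: T] (partial_sum m).
Proof.
rewrite /partial_sum; under eq_fun do rewrite big_mkcond.
by apply: measurable_sum => r; case: (r < m)%N => //; exact: measurable_funM.
Qed.

Let partial_var_ge0 m : 0 <= partial_var m.
Proof. by apply: sumr_ge0 => r _; exact: sqr_ge0. Qed.

Let lt_succ_neq m (i r : 'I_n) : nat_of_ord i = m ->
  ((r < m.+1)%N && (r != i)) = (r < m)%N.
Proof.
by move=> im; rewrite ltnS leq_eqVlt andb_orl -val_eqE /= im; case: ltngtP.
Qed.

Let cylinder_split i B B0 : (forall j, measurable (B j)) -> measurable B0 ->
  B i = setT ->
  cylinder (fun j => if j == i then B0 else B j) = eta i @^-1` B0 `&` cylinder B.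
Proof.
move=> mB mB0 BiT; apply/seteqP; split => w /=.
  move=> h; split; first by have /= := h i Logic.I; rewrite eqxx.
  move=> j _ /=; have /= := h j Logic.I; case: eqP => // -> _.
  by rewrite BiT.
by move=> [h0 h] j _ /=; case: eqP => [->//|_]; exact: h.
Qed.

(** Independence factorizes both cylinders; they differ only in factor [i], which equals 1 when
    [B i = setT]. *)
Let P_cylinder_split i B B0 : (forall j, measurable (B j)) -> measurable B0 ->
  B i = setT ->
  P (eta i @^-1` B0 `&` cylinder B) = (normal_prob 0 sigma B0 * P (cylinder B))%E.
Proof.
move=> mB mB0 BiT; rewrite -cylinder_split // !eta_indep //; last first.
  by move=> j; case: eqP.
rewrite (bigD1 i) //= [in RHS](bigD1 i) //= eqxx BiT preimage_setT probability_setT mul1e.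
rewrite -(eta_normal i) //; congr (_ * _)%E.
by apply: eq_bigr => j /negbTE ->.
Qed.

(* The cylinder constrains only the variables not yet summed, which is what lets
   the induction feed [eta m] into the sum. *)
Let partial_sum_law m B A : (m <= n)%N -> (forall i, measurable (B i)) ->
  (forall i : 'I_n, (i < m)%N -> B i = setT) -> measurable A ->
  P (partial_sum m @^-1` A `&` cylinder B) =
  (centered_normal (partial_var m) A * P (cylinder B))%E.
Proof.
elim: m B A => [|m IH] B A mn mB BT mA.
  (* The empty sum is constantly 0, so its law is the Dirac case of [centered_normal]. *)
  rewrite /partial_var big_pred0 // /centered_normal eqxx /=.
  have S0 w : partial_sum 0 w = 0 by rewrite /partial_sum big_pred0.
  rewrite diracE; have [A0|A0] := boolP (0 \in A).
    rewrite mul1e; congr (P _); apply/seteqP; split => w /=; first by case.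
    by move=> ?; split => //; rewrite S0; exact/set_mem.
  rewrite mul0e -[RHS](measure0 P); congr (P _).
  apply/seteqP; split => w //= -[]; rewrite S0 => /mem_set.
  by rewrite (negbTE A0).
pose i := Ordinal mn.
have -> : partial_sum m.+1 = (fun w => partial_sum m w + a i * eta i w).
  apply/funext => w; rewrite /partial_sum (bigD1 i) //= addrC; congr (_ + _).
  by apply: eq_bigl => r; rewrite lt_succ_neq.
have -> : partial_var m.+1 = partial_var m + (a i * sigma) ^+ 2.
  rewrite /partial_var (bigD1 i) //= addrC; congr (_ + _).
  by apply: eq_bigl => r; rewrite lt_succ_neq.
have Bi : B i = setT by apply: BT.
apply: centered_normal_sum => //.
- exact: measurable_cylinder.
- by rewrite gt_eqF.
(* The event on [eta i] is absorbed into the cylinder, which still leaves the first [m] coordinates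
   free, so the induction hypothesis applies. *)
move=> A' B0 mA' mB0; rewrite -setIA -(P_cylinder_split i) // -cylinder_split // IH //.
- exact: ltnW.
- by move=> j; case: eqP.
- move=> j jm; case: eqP => [ji|_]; first by move: jm; rewrite ji ltnn.
  by apply: BT; exact: ltnW.
Qed.

(** The partial sum at [m = n] with an unconstrained cylinder; its variance is [sigma^2] times the
    squared norm of [a]. *)
Lemma unit_combination_normal A : measurable A -> \sum_(r < n) a r ^+ 2 = 1 ->
  P ((fun w => \sum_(r < n) a r * eta r w) @^-1` A) = normal_prob 0 sigma A.
Proof.
move=> mA a1.
have := partial_sum_law n (fun=> setT) A (leqnn n) (fun=> measurableT) (fun _ _ => erefl) mA.
have -> : cylinder (fun=> setT) = setT.
  by apply/seteqP; split => // w _ j.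
rewrite setIT probability_setT mule1.
have -> : partial_var n = sigma ^+ 2.
  rewrite /partial_var; under eq_bigl do rewrite ltn_ord.
  by under eq_bigr do rewrite exprMn; rewrite -mulr_suml a1 mul1r.
rewrite /centered_normal gt_eqF ?exprn_gt0 // sqrtr_sqr gtr0_norm // => <-.
rewrite (_ : (fun w => _) = partial_sum n) //; apply/funext => w.
by apply: eq_bigl => r; rewrite ltn_ord.
Qed.

End NoiseProjection.

(** * Measurability of the recovery event *)

Section Alg1Event.
Context {R : realType} {d} {T : measurableType d} {n p : nat}.
Variables (X : 'M[R]_(n, p)) (y : 'I_n -> T -> R).
Hypothesis measurable_y : forall r, measurable_fun [set: T] (y r).

Lemma measurable_corr i : measurable_fun [set: T] (fun w => corr X (y^~ w) i).
Proof. by apply: measurable_sum => r; exact: measurable_funM. Qed.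

(** For fixed [S] the cardinality condition is deterministic, and the rest is a finite intersection
    of comparisons of measurable functions. *)
Lemma measurable_alg1_output k S : measurable [set w | alg1_output X (y^~ w) k S].
Proof.
have [cS|cS] := eqVneq #|S| k; last first.
  rewrite (_ : [set w | _] = set0) //; apply/seteqP; split => // w [/eqP].
  by rewrite (negbTE cS).
pose F i j := if (i \in S) && (j \notin S) then
  [set w | `|corr X (y^~ w) j| <= `|corr X (y^~ w) i|] else setT.
rewrite (_ : [set w | _] = \bigcap_(i in [set: 'I_p]) \bigcap_(j in [set: 'I_p]) F i j).
  apply: fin_bigcap_measurable => [|i _]; first exact: finite_finset.
  apply: fin_bigcap_measurable => [|j _]; first exact: finite_finset.
  rewrite /F; case: ifP => // _; rewrite -[X in measurable X]setTI.
  by apply: measurable_fun_le => //; apply: measurableT_comp => //; exact: measurable_corr.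
apply/seteqP; split => w /=.
  by move=> [_ h] i _ j _; rewrite /F; case: ifP => // /andP[iS jS]; exact: h.
move=> h; split => // i j iS jS.
by have := h i Logic.I j Logic.I; rewrite /F iS jS.
Qed.

(** An intersection over countably many [k] and finitely many [S]. [Q] and [Q'] stand for the two
    deterministic constraints on the parameter in the theorem. *)
Lemma measurable_alg1_subset (Q Q' : pred nat) (U : {set 'I_p}) :
  measurable [set w | forall k : nat, Q k -> Q' k -> forall S : {set 'I_p},
    alg1_output X (y^~ w) k S -> U \subset S].
Proof.
pose F k (S : {set 'I_p}) := if [&& Q k, Q' k & ~~ (U \subset S)] then
  ~` [set w | alg1_output X (y^~ w) k S] else setT.
rewrite (_ : [set w | _] = \bigcap_k \bigcap_(S in [set: {set 'I_p}]) F k S).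
  apply: bigcapT_measurable => k.
  apply: fin_bigcap_measurable => [|S _]; first exact: finite_finset.
  by rewrite /F; case: ifP => // _; apply: measurableC; exact: measurable_alg1_output.
apply/seteqP; split => w /=.
  move=> h k _ S _; rewrite /F; case: ifP => // /and3P[Qk Q'k /negP US] /= /h.
  by move=> /(_ Qk Q'k).
move=> h k Qk Q'k S out; apply: contraT => US.
by have := h k Logic.I S Logic.I; rewrite /F Qk Q'k US => /(_ out).
Qed.

End Alg1Event.

(** * Tail at the threshold and failure probability *)

(** At twice [sigma sqrt(ln p)] the Gaussian exponent is [- 2 ln p], hence the factor [p^-2]; one
    power of [p] is spent on the union bound. *)
Lemma normal_tail_threshold {R : realType} (sigma : R) (p : nat) :
  0 < sigma -> (2 <= p)%N ->
  2 * (sigma ^+ 2 / (2 * Num.sqrt (sigma ^+ 2 * ln p%:R))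
       * normal_pdf 0 sigma (2 * Num.sqrt (sigma ^+ 2 * ln p%:R))) =
  (p%:R ^+ 2 * Num.sqrt (2 * pi * ln p%:R))^-1.
Proof.
move=> s0 p2; set L := ln _.
have p0 : 0 < p%:R :> R by rewrite ltr0n (leq_trans _ p2).
have L0 : 0 < L by rewrite ln_gt0 // ltr1n.
have l0 : 0 < Num.sqrt L by rewrite sqrtr_gt0.
have q0 : 0 < Num.sqrt (2 * pi) :> R by rewrite sqrtr_gt0 mulr_gt0 ?pi_gt0.
have lL := sqr_sqrtr (ltW L0).
rewrite normal_pdfE ?gt_eqF // /normal_peak /normal_fun subr0.
have -> : Num.sqrt (sigma ^+ 2 * L) = sigma * Num.sqrt L.
  by rewrite sqrtrM ?sqr_ge0 // sqrtr_sqr gtr0_norm.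
have -> : Num.sqrt (sigma ^+ 2 * pi *+ 2) = sigma * Num.sqrt (2 * pi).
  by rewrite -mulrnAr sqrtrM ?sqr_ge0 // sqrtr_sqr gtr0_norm // mulr_natl.
have -> : Num.sqrt (2 * pi * L) = Num.sqrt (2 * pi) * Num.sqrt L.
  by rewrite sqrtrM // mulr_ge0 ?pi_ge0.
have -> : expR (- (2 * (sigma * Num.sqrt L)) ^+ 2 / (sigma ^+ 2 *+ 2)) = (p%:R ^+ 2)^-1 :> R.
  have -> : - (2 * (sigma * Num.sqrt L)) ^+ 2 / (sigma ^+ 2 *+ 2) = - (2%:R * L).
    by rewrite -[in RHS]lL; field; rewrite gt_eqF.
  by rewrite expRN expRM_natl lnK.
by field; rewrite !gt_eqF.
Qed.

Theorem theorem3 (R : realType) (n p k : nat) (X : 'M[R]_(n, p))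
  (beta : 'I_p -> R) (sigma bmin : R)
  (dT : measure_display) (T : measurableType dT) (P : probability T R)
  (eta : 'I_n -> {RV P >-> R}) :
  (2 <= p)%N ->
  (k < n)%N ->
  0 < sigma ->
  unit_norm_cols X ->
  0 < coherence X ->
  #|supp beta| = k ->
  (forall i, i \in supp beta -> bmin <= `|beta i|) ->
  (exists2 i, i \in supp beta & `|beta i| = bmin) ->
  (forall i : 'I_n, forall A : set R, measurable A ->
     distribution P (eta i) A = normal_prob 0 sigma A) ->
  mutually_independent_RV eta ->
  k%:R < (coherence X)^-1 ->
  bmin / l2norm beta >
    2 * coherence X * Num.sqrt k%:R
    + 4 * Num.sqrt (sigma ^+ 2 * ln p%:R) / l2norm beta ->
  (P [set w : T | forall d : nat, (d <= p)%N ->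
        (Num.ceil (Num.sqrt k%:R /
            (bmin / l2norm beta - 2 * coherence X * Num.sqrt k%:R
             - 4 * Num.sqrt (sigma ^+ 2 * ln p%:R) / l2norm beta)) <= d%:Z)%R ->
        forall Shat : {set 'I_p},
          alg1_output X (response X beta (fun r => eta r w)) d Shat ->
          supp beta \subset Shat]
   > (1 - 2 / (p%:R * Num.sqrt (2 * pi * ln p%:R)))%:E)%E.
Proof.
move=> p2 _ s0 uX mu0 cS hb [i0 i0S b0E] eta_normal eta_indep _ snr.
(* This [tau] is half the noise level: noise correlations are compared with [2 * tau]. *)
set tau := Num.sqrt (sigma ^+ 2 * ln p%:R) in snr *.
set G := (X in (_ < P X)%E).
have p0 : 0 < p%:R :> R by rewrite ltr0n (leq_trans _ p2).
have L0 : 0 < ln p%:R :> R by rewrite ln_gt0 // ltr1n.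
have tau0 : 0 < tau by rewrite sqrtr_gt0 mulr_gt0 ?exprn_gt0.
have bmin0 : 0 < bmin by rewrite -b0E normr_gt0; move: i0S; rewrite inE.
have measurable_eta r : measurable_fun [set: T] (eta r) by [].
have mG : measurable G.
  apply: (measurable_alg1_subset X
    (fun r w => response X beta (fun r => eta r w) r)).
  move=> r; apply: measurable_funD => //.
pose bad (i : 'I_p) : set T :=
  [set w | 2 * tau <= `|corr X (fun r => eta r w) i|].
have mbad i : measurable (bad i).
  rewrite -[bad i]setTI; apply: measurable_fun_le => //.
  by apply: measurableT_comp => //; exact: measurable_corr.
(* The union bound will give failure probability at most [1 / q], half of the allowed [2 / q]. *)
pose q : R := p%:R * Num.sqrt (2 * pi * ln p%:R).
have q0 : 0 < q by rewrite mulr_gt0 // sqrtr_gt0 !mulr_gt0 ?pi_gt0.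
have Pbad i : (P (bad i) <= ((p%:R * q)^-1)%:E)%E.
  have mI : measurable [set x : R | 2 * tau <= `|x|].
    rewrite -[X in measurable X]setTI.
    by apply: measurable_fun_le => //; exact: measurableT_comp.
  have -> : P (bad i) = normal_prob 0 sigma [set x : R | 2 * tau <= `|x|].
    rewrite -(unit_combination_normal eta sigma (X^~ i) s0 eta_normal eta_indep) //.
    by rewrite -(uX i); apply: eq_bigr => r _; rewrite expr2.
  rewrite (le_trans (normal_two_sided_tail _ _ s0 _)) ?mulr_gt0 // lee_fin.
  by rewrite normal_tail_threshold // /q mulrA -expr2.
pose B := \bigcup_(i in [set: 'I_p]) bad i.
have mB : measurable B.
  by apply: fin_bigcup_measurable => // ; exact: finite_finset.
have PB : (P B <= (q^-1)%:E)%E.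
  rewrite (le_trans (content_sub_fsum P (finite_finset : finite_set [set: 'I_p]) (fun i _ => mbad i) mB _)) //.
  rewrite (fsbigE (index_enum 'I_p)) ?index_enum_uniq //; last first.
    by move=> i _; rewrite mem_index_enum.
  under eq_bigl do rewrite in_setT.
  apply: (@le_trans _ _ (\sum_(i < p) ((p%:R * q)^-1)%:E)%E).
    by apply: lee_sum => i _; exact: Pbad.
  by rewrite sumEFin lee_fin sumr_const card_ord -[leLHS]mulr_natl invfM mulrA divff ?gt_eqF // mul1r.
have BG : ~` B `<=` G.
  move=> w Bw k0 kp kc Shat out.
  have noise i : `|corr X (fun r => eta r w) i| <= 2 * tau.
    by rewrite leNgt; apply/negP => /ltW h; apply: Bw; exists i.
  apply: (alg1_output_supp _ _ _ bmin (2 * tau) _ _ uX bmin0 hb noise _ out).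
  set l1 := \sum_(j < p) _; set N := l2norm beta in snr kc.
  set mu := coherence X in snr kc mu0 *; set D := (X in _ / X) in kc.
  have l1N : l1 <= Num.sqrt k%:R * N by rewrite -cS; exact: l1norm_le_sqrt_supp.
  have N0 : 0 < N.
    rewrite sqrtr_gt0 (bigD1 i0) //= ltr_pwDl ?exprn_even_gt0 //=.
      by move: i0S; rewrite inE.
    by apply: sumr_ge0 => j _; exact: sqr_ge0.
  (* Positivity of the denominator is the signal-to-noise hypothesis; multiplying by [N] then clears
     the normalization by the l2 norm. *)
  have D0 : 0 < D by rewrite /D; move: snr; lra.
  have DN : D * N = bmin - 2 * mu * (Num.sqrt k%:R * N) - 2 * (2 * tau).
    by rewrite /D; field; rewrite gt_eqF.
  have kd : Num.sqrt k%:R <= k0%:R * D.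
    by rewrite -ler_pdivrMr //; move: kc; rewrite ceil_le_int.
  apply: (le_trans l1N).
  (* The ceiling bound gives [sqrt k * N <= d * D * N]; replacing [sqrt k * N] by the smaller [l1]
     inside [D * N] only enlarges the right-hand side. *)
  apply: (@le_trans _ _ (k0%:R * (D * N))); first by rewrite mulrA ler_pM2r.
  by rewrite DN ler_wpM2l // lerD2r lerD2l lerN2 ler_pM2l // mulr_gt0.
apply: (@lt_le_trans _ _ (P (~` B))).
  rewrite probability_setC // -/q.
  apply: (@lt_le_trans _ _ (1 - (q^-1)%:E)%E); last exact: leeB.
  (* Strictness comes from [1 / q < 2 / q]. *)
  by rewrite -EFinB lte_fin ltrD2l ltrN2 ltr_pMl ?invr_gt0 // ltr1n.
by apply: le_measure; rewrite ?inE //; exact: measurableC.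
Qed.
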